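(* Let $F$ be an absolutely continuous probability distribution on $[0,1]^d$, different from the uniform distribution, with a density $f$ that is positive almost everywhere on $[0,1]^d$. Let $v_F$ be an $F$-Brownian bridge. Then the process $u=\{u(x), x\in[0,1]^d\}$ with the differential $$u(\mathrm{d}x) = \frac{1}{\sqrt{f(x)}}\, v_F(\mathrm{d}x) - \frac{1- \sqrt{f(x)}}{1-\int_{[0,1]^d} \sqrt{f(y)} \,\mathrm{d}y}\int_{[0,1]^d}\frac{1}{\sqrt{f(y)}}\, v_F(\mathrm{d}y) \,\mathrm{d}x$$ is a standard Brownian bridge on $[0,1]^d$.
   Context: For a probability distribution $F$ on $\mathbb{R}^d$, write $\langle\phi,\tilde\phi\rangle_F=\int\phi\tilde\phi\,\mathrm{d}F$ and let $q_0$ be the function identically equal to $1$. An $F$-Brownian motion $w_F$ is a family of centered jointly Gaussian random variables $w_F(\phi)$, $\phi\in L_2(F)$, (a.s.) linear in $\phi$, with $E\,w_F(\phi)w_F(\tilde\phi)=\langle\phi,\tilde\phi\rangle_F$. An $F$-Brownian bridge is a family distributed as $v_F(\phi)=w_F(\phi)-\langle\phi,q_0\rangle_F w_F(q_0)$, $\phi\in L_2(F)$; equivalently it is linear, centered Gaussian with covariance $\langle\phi,\tilde\phi\rangle_F-\langle\phi,q_0\rangle_F\langle\tilde\phi,q_0\rangle_F$. Stochastic integrals are defined by $\int \phi(y)\,v_F(\mathrm{d}y)=v_F(\phi)$, and the point-parametric form is $v_F(x)=v_F(\mathbf 1_{(-\infty,x]})$, with $(-\infty,x]=(-\infty,x_1]\times\cdots\times(-\infty,x_d]$.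 When $F$ is the uniform distribution on $[0,1]^d$, an $F$-Brownian bridge is called a standard Brownian bridge. Specifying a process $u$ by its differential means $u(x)=\int_{y\le x}u(\mathrm{d}y)$ (coordinatewise inequality), with $\int_{y\le x}\frac{1}{\sqrt{f(y)}}v_F(\mathrm{d}y)=v_F(\mathbf 1_{(-\infty,x]}/\sqrt f)$. *)

(* Defs.v *)
From HB Require Import structures.
From mathcomp Require Import all_boot all_order all_algebra.
From mathcomp Require Import all_classical all_reals all_analysis.

Set Implicit Arguments.
Unset Strict Implicit.
Unset Printing Implicit Defensive.

Import Order.TTheory GRing.Theory Num.Theory.
Import numFieldNormedType.Exports.

Local Open Scope classical_set_scope.
Local Open Scope ring_scope.

Definition tuple_cons (R : realType) n (p : measurableTypeR R * n.-tuple R) :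
  n.+1.-tuple R := [tuple of (p.1 : R) :: p.2].

Lemma measurable_tuple_cons (R : realType) n :
  measurable_fun setT (@tuple_cons R n).
Proof.
exact: (@measurable_cons _ _ (measurableTypeR R * n.-tuple R)%type R).
Qed.

(* Lebesgue measure on R^n: the product of lebesgue_measure and Lebesgue measure
   on R^(n-1), transported along (x, t) |-> x :: t. *)
Fixpoint lebesgue_tuple (R : realType) (n : nat) : set (n.-tuple R) -> \bar R :=
  match n with
  | 0 => dirac [tuple]
  | m.+1 => pushforward (lebesgue_measure \x @lebesgue_tuple R m)%E
              (@tuple_cons R m)
  end.
Arguments lebesgue_tuple : clear implicits.

Section lebesgue_tuple_cons.
Variables (R : realType) (n : nat).
Variable m : {sigma_finite_measure set (n.-tuple R) -> \bar R}.

Definition lebesgue_tuple_cons : set (n.+1.-tuple R) -> \bar R :=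
  pushforward (@lebesgue_measure R \x m)%E (@tuple_cons R n).

Let cons0 : lebesgue_tuple_cons set0 = 0%E.
Proof. by rewrite /lebesgue_tuple_cons /pushforward preimage_set0 measure0. Qed.

Let cons_ge0 A : (0 <= lebesgue_tuple_cons A)%E.
Proof. exact: (measure_ge0 (@lebesgue_measure R \x m)%E). Qed.

Let cons_sigma_additive : semi_sigma_additive lebesgue_tuple_cons.
Proof.
have mc := @measurable_tuple_cons R n.
have mpre A : measurable A -> measurable (@tuple_cons R n @^-1` A).
  by move=> mA; rewrite -[X in measurable X]setTI; exact: mc.
move=> F mF tF mUF; rewrite /lebesgue_tuple_cons /pushforward preimage_bigcup.
apply: measure_semi_sigma_additive.
- by move=> k; exact: mpre.
- apply/trivIsetP => /= i j _ _ ij; rewrite -preimage_setI.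
  by move/trivIsetP : tF => /(_ _ _ _ _ ij) ->//; rewrite preimage_set0.
- by rewrite -preimage_bigcup; exact: mpre.
Qed.

HB.instance Definition _ := isMeasure.Build _ _ _ lebesgue_tuple_cons
  cons0 cons_ge0 cons_sigma_additive.

Let cons_sigma_finite : sigma_finite setT lebesgue_tuple_cons.
Proof.
have /sigma_finiteP[F [TF ndF Foo]] := sigma_finiteT (@lebesgue_measure R).
have /sigma_finiteP[G [TG ndG Goo]] := sigma_finiteT m.
pose un (t : n.+1.-tuple R) : measurableTypeR R * n.-tuple R :=
  (thead t, [tuple of behead t]).
have mun : measurable_fun setT un.
  apply: measurable_fun_pair; last exact: measurable_behead.
  exact: measurable_tnth.
have unK p : un (tuple_cons p) = p.
  by case: p => x t; congr pair; exact/val_inj.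
exists (fun k => un @^-1` (F k `*` G k)).
  apply/esym; rewrite -subTset => t _.
  have [i _ Fi] : (\bigcup_i F i) (un t).1 by rewrite -TF.
  have [j _ Gj] : (\bigcup_j G j) (un t).2 by rewrite -TG.
  exists (maxn i j) => //; split.
  - by move: Fi; exact/subsetPset/ndF/leq_maxl.
  - by move: Gj; exact/subsetPset/ndG/leq_maxr.
move=> k; have [mF Fk] := Foo k; have [mG Gk] := Goo k; split.
  by rewrite -[X in measurable X]setTI; apply: mun => //; exact: measurableX.
rewrite /lebesgue_tuple_cons /pushforward.
rewrite (_ : _ @^-1` _ = F k `*` G k); last first.
  by apply/funext => p; rewrite /preimage /mkset unK.
by rewrite product_measure1E// lte_mul_pinfty// ge0_fin_numE.
Qed.

HB.instance Definition _ := Measure_isSigmaFinite.Build _ _ _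
  lebesgue_tuple_cons cons_sigma_finite.

End lebesgue_tuple_cons.

Section lebesgue_tuple_measure.
Variables (R : realType) (n : nat).

Let lebesgue_tuple_ex k :
  exists m : {sigma_finite_measure set (k.-tuple R) -> \bar R},
    (m : set (k.-tuple R) -> \bar R) = lebesgue_tuple R k.
Proof.
elim: k => [|k [m mE]]; first by exists (dirac [tuple]).
by exists (lebesgue_tuple_cons m); rewrite /= -mE.
Qed.

Let lebesgue_tuple0 : lebesgue_tuple R n set0 = 0%E.
Proof. by have [m <-] := lebesgue_tuple_ex n; exact: measure0. Qed.

Let lebesgue_tuple_ge0 A : (0 <= lebesgue_tuple R n A)%E.
Proof. by have [m <-] := lebesgue_tuple_ex n; exact: measure_ge0. Qed.

Let lebesgue_tuple_sigma_additive : semi_sigma_additive (lebesgue_tuple R n).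
Proof.
by have [m <-] := lebesgue_tuple_ex n; exact: measure_semi_sigma_additive.
Qed.

HB.instance Definition _ := isMeasure.Build _ _ _ (lebesgue_tuple R n)
  lebesgue_tuple0 lebesgue_tuple_ge0 lebesgue_tuple_sigma_additive.

Let lebesgue_tuple_sigma_finite : sigma_finite setT (lebesgue_tuple R n).
Proof. by have [m <-] := lebesgue_tuple_ex n; exact: sigma_finiteT. Qed.

HB.instance Definition _ := Measure_isSigmaFinite.Build _ _ _
  (lebesgue_tuple R n) lebesgue_tuple_sigma_finite.

End lebesgue_tuple_measure.

Definition cube (R : realType) d : set (d.-tuple R) :=
  [set x | forall i, 0 <= tnth x i <= 1].
Arguments cube : clear implicits.

Lemma cubeS (R : realType) d :
  @tuple_cons R d @^-1` cube R d.+1 = `[0, 1]%classic `*` cube R d.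
Proof.
apply/seteqP; split=> [[x t] h|[x t] [/= x01 ht] i] /=.
- split; first by have := h ord0; rewrite tnth0 /= in_itv.
  by move=> i; have := h (lift ord0 i); rewrite /tuple_cons tnthS.
- case: (unliftP ord0 i) => [j ->|->].
    by rewrite tnthS; exact: ht.
  by rewrite tnth0; move: x01; rewrite in_itv.
Qed.

Lemma measurable_cube (R : realType) d : measurable (cube R d).
Proof.
rewrite (_ : cube R d =
  \bigcap_(i in [set: 'I_d]) ((fun x => tnth x i) @^-1` `[0, 1]%classic)).
  apply: fin_bigcap_measurable => // i _; rewrite -[X in measurable X]setTI.
  by apply: measurable_tnth => //; exact: measurable_itv.
apply/seteqP; split => x h i; last by have := h i I; rewrite /= in_itv.
by move=> _; have := h i; rewrite /= in_itv.
Qed.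

Lemma lebesgue_tuple_cube (R : realType) d : lebesgue_tuple R d (cube R d) = 1%E.
Proof.
elim: d => [|d IHd]; first by rewrite /= diracE mem_set// => -[].
rewrite /= /pushforward cubeS product_measure1E//=; last exact: measurable_cube.
by rewrite IHd mule1 lebesgue_measure_itv/= lte_fin ltr01 oppr0 adde0.
Qed.

(* A |-> Lebesgue measure of A `&` [0, 1]^d. *)
Definition uniform_cube (R : realType) d : set (d.-tuple R) -> \bar R :=
  mrestr (lebesgue_tuple R d) (@measurable_cube R d).
Arguments uniform_cube : clear implicits.

HB.instance Definition _ (R : realType) d :=
  Measure.on (uniform_cube R d).

Lemma uniform_cube_setT (R : realType) d : uniform_cube R d setT = 1%E.
Proof. by rewrite /uniform_cube /mrestr setTI lebesgue_tuple_cube. Qed.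

HB.instance Definition _ (R : realType) d :=
  Measure_isProbability.Build _ _ _ (uniform_cube R d) (uniform_cube_setT R d).

(* (-oo, x] = (-oo, x_1] x ... x (-oo, x_d] *)
Definition orthant (R : realType) d (x : d.-tuple R) : set (d.-tuple R) :=
  [set y | forall i, tnth y i <= tnth x i].

Definition is_density (R : realType) d (F : probability (d.-tuple R) R)
    (f : d.-tuple R -> R) :=
  [/\ measurable_fun setT f,
      forall x, 0 <= f x &
      forall A, measurable A ->
        F A = (\int[lebesgue_tuple R d]_(x in A) (f x)%:E)%E].

Definition inner (R : realType) d (F : probability (d.-tuple R) R)
    (phi psi : d.-tuple R -> R) : R :=
  \int[F]_y (phi y * psi y).

Section bridges.
Context {disp : measure_display} {T : measurableType disp} {R : realType}.
Variable P : probability T R.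

(* Degenerate variables are Gaussian; they need a separate clause because
   normal_prob 0 0 is by convention not the Dirac mass at 0. *)
Definition centered_gaussian (X : T -> R) :=
  measurable_fun setT X /\
  exists s : R, forall A : set R, measurable A ->
    P (X @^-1` A) = if s == 0 then \d_(0 : R) A else normal_prob 0 s A.

(* Elements of L_2(F) are represented by functions; the covariance and the
   linearity force v phi = v psi almost surely when phi = psi F-almost
   everywhere. The values of v outside L_2(F) are irrelevant. Joint Gaussianity
   is that of all finite linear combinations. *)
Definition brownian_bridge d (F : probability (d.-tuple R) R)
    (v : (d.-tuple R -> R) -> {RV P >-> R}) :=
  [/\ forall (a b : R) (phi psi : d.-tuple R -> R),
        phi \in Lfun F 2%:E -> psi \in Lfun F 2%:E ->
        {ae P, forall w,
          v (fun y => a * phi y + b * psi y) w = a * v phi w + b * v psi w},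
      forall n (phi : 'I_n -> d.-tuple R -> R) (a : 'I_n -> R),
        (forall i, phi i \in Lfun F 2%:E) ->
        centered_gaussian (fun w => \sum_(i < n) a i * v (phi i) w) &
      forall phi psi : d.-tuple R -> R,
        phi \in Lfun F 2%:E -> psi \in Lfun F 2%:E ->
        covariance P (v phi) (v psi) =
          (inner F phi psi
             - inner F phi (cst 1) * inner F psi (cst 1))%:E].

(* u is a version of the point-parametric form x |-> v((-oo, x]) of a bridge v
   for the uniform distribution. *)
Definition standard_brownian_bridge d (u : d.-tuple R -> T -> R) :=
  exists v : (d.-tuple R -> R) -> {RV P >-> R},
    brownian_bridge (uniform_cube R d) v /\
    forall x, cube R d x ->
      {ae P, forall w, u x w = v \1_(orthant x) w}.

(* The differential of u integrated over {y <= x}, with v phi for the stochastic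
   integral of phi. *)
Definition transformed_bridge d (f : d.-tuple R -> R)
    (v : (d.-tuple R -> R) -> {RV P >-> R}) (x : d.-tuple R) (w : T) : R :=
  v (fun y => \1_(orthant x) y / Num.sqrt (f y)) w
  - (\int[lebesgue_tuple R d]_(y in cube R d `&` orthant x)
       (1 - Num.sqrt (f y)))
    / (1 - \int[lebesgue_tuple R d]_(y in cube R d) Num.sqrt (f y))
    * v (fun y => \1_(cube R d) y / Num.sqrt (f y)) w.

End bridges.

(* Main.v *)
Require Import Defs.
From HB Require Import structures.
From mathcomp Require Import all_boot all_order all_algebra.
From mathcomp Require Import all_classical all_reals all_analysis.
From mathcomp Require Import measurable_realfun ring lra.

Set Implicit Arguments.
Unset Strict Implicit.
Unset Printing Implicit Defensive.

Import Order.TTheory GRing.Theory Num.Theory.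
Import numFieldNormedType.Exports.

Local Open Scope classical_set_scope.
Local Open Scope ring_scope.

(** Write [lam] for the uniform distribution on the cube, [s] for the square
    root of the density [f], and [<.,.>] for the inner product of L_2([lam]).

    Division by [s] is an isometry from L_2([lam]) into L_2(F), because
    [(phi / s) * (psi / s) * f = phi * psi] wherever [f > 0], which is almost
    everywhere in the cube ([inner_rescale]). Composing a Brownian bridge for F
    with this isometry gives a centered Gaussian process [phi |-> v (phi / s)],
    linear almost surely. The bridge for F is a Brownian motion conditioned to
    vanish at the constant function, and this function corresponds to the unit
    vector [s] of L_2([lam]) ([inner_rescale_cst1]), so the new process has
    covariance [<phi, psi> - <phi, s> <psi, s>] where the standard bridge has
    [<phi, psi> - <phi, 1> <psi, 1>].

    The second term of the differential turns the removed direction from the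
    unit vector [s] to the unit vector [1]. With
    [c phi = <phi, 1 - s> / (1 - <1, s>)], the process
    [phi |-> v (phi / s) - c phi * v (1 / s)] is again linear and Gaussian, and
    bilinearity of covariance gives it the covariance of the standard bridge
    ([transform_covariance]); this is composition with the reflection of
    L_2([lam]) that exchanges [s] and [1]. At the indicator of an orthant, it is
    the process of the theorem ([transformed_bridgeE]).

    The denominator is nonzero because F is not uniform: as [s] and [1] are
    unit vectors, [<1, s> = 1] would give [<1 - s, 1 - s> = 0], hence [f = 1]
    almost everywhere in the cube ([hellinger_affinity_neq1]). *)

(** * Integration against a measure with a density *)

Section density.
Context {d : measure_display} {T : measurableType d} {R : realType}.
Context (mu : {sigma_finite_measure set T -> \bar R}).
Context (nu : {finite_measure set T -> \bar R}) (g : T -> R).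
Context (mg : measurable_fun setT g) (g_ge0 : forall x, 0 <= g x).
Context (nuE : forall A, measurable A -> nu A = (\int[mu]_(x in A) (g x)%:E)%E).

(** By uniqueness of densities, [g] agrees [mu]-almost everywhere with the
    Radon-Nikodym derivative of [nu], for which the change of variables is
    known. *)
Lemma ge0_integral_density (h : T -> \bar R) :
  (forall x, 0 <= h x)%E -> measurable_fun setT h ->
  (\int[nu]_x h x = \int[mu]_x (h x * (g x)%:E))%E.
Proof.
move=> h0 mh.
have mEg : measurable_fun setT (EFin \o g) by exact/measurable_EFinP.
have numu : nu `<< mu.
  apply/null_content_dominatesP => A mA muA0; rewrite nuE//.
  rewrite (ae_eq_integral (cst 0%E))// ?integral0//.
    exact: measurable_funTS.
  exact: ae_eq0.
rewrite -(Radon_Nikodym_SigmaFinite.change_of_variables numu)//.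
have iRN := Radon_Nikodym_SigmaFinite.f_integrable numu.
have aeg : ae_eq mu setT (Radon_Nikodym_SigmaFinite.f nu mu) (EFin \o g).
  apply: integral_ae_eq => // A _ mA.
  by rewrite -Radon_Nikodym_SigmaFinite.f_integral// nuE.
apply: ge0_ae_eq_integral => //.
- exact: emeasurable_funM (measurable_int _ iRN).
- exact: emeasurable_funM.
- by move=> x _; rewrite mule_ge0// Radon_Nikodym_SigmaFinite.f_ge0.
- by move=> x _; rewrite mule_ge0// lee_fin.
- exact: ae_eqe_mul2l.
Qed.

(** Multiplication by the nonnegative [g] commutes with taking positive and
    negative parts. *)
Lemma integral_density (h : T -> R) : measurable_fun setT h ->
  (\int[nu]_x (h x)%:E = \int[mu]_x (h x * g x)%:E)%E.
Proof.
move=> mh; rewrite integralE [RHS]integralE.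
have mh' : measurable_fun setT (EFin \o h) by exact/measurable_EFinP.
rewrite !ge0_integral_density//; last 2 first.
- exact: measurable_funeneg.
- exact: measurable_funepos.
congr (_ - _)%E; apply: eq_integral => x _.
- by rewrite !funeposE -!EFin_max -EFinM maxr_pMl// mul0r.
- by rewrite !funenegE -!EFinN -!EFin_max -EFinM maxr_pMl// mul0r mulNr.
Qed.
End density.

(** * Square-integrable functions and random variables *)

Section square_integrable.
Context {d : measure_display} {T : measurableType d} {R : realType}.

Lemma integral_probability1 (P : probability T R) : (\int[P]_x 1%:E = 1)%E.
Proof.
by rewrite (eq_integral (cst 1%E))// integral_cst//= mul1e probability_setT.
Qed.

Lemma Lfun2P (mu : {measure set T -> \bar R}) (f : T -> R) :
  f \in Lfun mu 2%:E <->
  measurable_fun setT f /\ (\int[mu]_x (f x ^+ 2)%:E < +oo)%E.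
Proof.
split=> [f2|[mf f2]].
  split; first by case/andP: f2; rewrite inE.
  have /integrableP[_] := Lfun2_integrable_sqr f2.
  by under eq_integral do rewrite /= ger0_norm ?sqr_ge0//.
apply/andP; split; rewrite inE//=.
rewrite /finite_norm unlock /Lnorm poweR_lty//.
under eq_integral => x _ do
  rewrite /= powR_mulrn ?normr_ge0// real_normK ?num_real//.
by [].
Qed.

Lemma Lfun2_lin (mu : {measure set T -> \bar R}) (f g : T -> R) (a b : R) :
  f \in Lfun mu 2%:E -> g \in Lfun mu 2%:E ->
  (fun x => a * f x + b * g x) \in Lfun mu 2%:E.
Proof.
move=> f2 g2; have closed := @Lfun_submod_closed _ _ _ mu _ (lee1n 2).
apply: (closed.2 a f (fun x => b * g x)) => //.
rewrite (_ : (fun _ => _) = b *: (g : T -> R^o) + 0); last by rewrite addr0.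
exact: closed.2 closed.1.
Qed.

(** The variance is the integral of the square of [X - c], with [c] the real
    number that [fine] extracts from the expectation, whether or not that
    expectation is finite. A finite variance thus puts [X - c], and then [X], in
    L_2. This gives the square-integrability of a bridge from its covariance,
    with no computation of Gaussian moments. *)
Lemma finite_variance_Lfun2 (P : probability T R) (X : {RV P >-> R}) :
  covariance P X X \is a fin_num -> (X : T -> R) \in Lfun P 2%:E.
Proof.
rewrite covariance.unlock unlock; set c := fine _ => covX.
have L2c : (X \- cst c) \in Lfun P 2%:E.
  apply/Lfun2P; split; first exact: measurable_funB.
  by rewrite ltey_eq covX.
rewrite (_ : (X : T -> R) = fun w => 1 * (X \- cst c) w + 1 * cst c w).
  by apply: Lfun2_lin => //; exact: Lfun_cst.
by apply/funext => w /=; rewrite !mul1r subrK.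
Qed.

Lemma covariance_shift (P : probability T R) (X Y Z : T -> R) (a b : R) :
  X \in Lfun P 2%:E -> Y \in Lfun P 2%:E -> Z \in Lfun P 2%:E ->
  covariance P (X \- a \o* Z) (Y \- b \o* Z) =
    (covariance P X Y - b%:E * covariance P X Z
     - (a%:E * covariance P Z Y - (a * b)%:E * covariance P Z Z))%E.
Proof.
move=> X2 Y2 Z2.
have L1 (U : T -> R) : U \in Lfun P 2%:E -> U \in Lfun P 1.
  by apply: Lfun_subset12; exact: fin_num_measure.
have L11 (U V : T -> R) : U \in Lfun P 2%:E -> V \in Lfun P 2%:E ->
  U * V \in Lfun P 1 by exact: Lfun2_mul_Lfun1.
have L2Z r : r \o* Z \in Lfun P 2%:E by apply: Lfun_scale => //; rewrite ler1n.
have L2B : Y \- b \o* Z \in Lfun P 2%:E.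
  rewrite (_ : _ \- _ = fun x => 1 * Y x + (- b) * Z x); first exact: Lfun2_lin.
  by apply/funext => x /=; rewrite mul1r mulNr mulrC.
have L11' r : Z * (r \o* Z) \in Lfun P 1 by apply: L11.
rewrite covarianceBl// !covarianceBr//.
rewrite (covarianceZr b (L1 _ X2) (L1 _ Z2) (L11 _ _ X2 Z2)).
rewrite (covarianceZl a (L1 _ Z2) (L1 _ Y2) (L11 _ _ Z2 Y2)).
rewrite (covarianceZl a (L1 _ Z2) (L1 _ (L2Z b)) (L11' b)).
by rewrite (covarianceZr b (L1 _ Z2) (L1 _ Z2) (L11 _ _ Z2 Z2)) EFinM muleA.
Qed.
End square_integrable.

Lemma innerC {R : realType} {d : nat} (F : probability (d.-tuple R) R)
  (phi psi : d.-tuple R -> R) : inner F phi psi = inner F psi phi.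
Proof. by apply: eq_Rintegral => y _; rewrite mulrC. Qed.

Lemma inner_lin {R : realType} {d : nat} (F : probability (d.-tuple R) R)
  (a b : R) (phi psi chi : d.-tuple R -> R) :
  phi \in Lfun F 2%:E -> psi \in Lfun F 2%:E -> chi \in Lfun F 2%:E ->
  inner F (fun y => a * phi y + b * psi y) chi =
    a * inner F phi chi + b * inner F psi chi.
Proof.
move=> phi2 psi2 chi2.
have int (u : d.-tuple R -> R) : u \in Lfun F 2%:E ->
    F.-integrable setT (EFin \o (fun y => u y * chi y)).
  by move=> u2; apply/Lfun1_integrable; exact: Lfun2_mul_Lfun1.
rewrite /inner -!RintegralZl ?int// -RintegralD//.
- by apply: eq_Rintegral => y _; rewrite mulrDl !mulrA.
- exact: (integrableZl measurableT a (int _ phi2)).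
- exact: (integrableZl measurableT b (int _ psi2)).
Qed.

Lemma inner_cst11 {R : realType} {d : nat} (F : probability (d.-tuple R) R) :
  inner F (cst 1) (cst 1) = 1.
Proof.
rewrite /inner /Rintegral (eq_integral (fun=> 1%:E)) => [|y _].
  by rewrite integral_probability1.
by rewrite mulr1.
Qed.

(** * The isometry from L_2 of the uniform distribution to L_2(F) *)

Definition rescale {R : realType} {d : nat} (f phi : d.-tuple R -> R) :
  d.-tuple R -> R := fun y => phi y / Num.sqrt (f y).

Section rescaling.
Context {R : realType} {d : nat} (F : probability (d.-tuple R) R).
Context (f : d.-tuple R -> R).
Context (F_cube : F (cube R d) = 1%E) (F_density : is_density F f).
Context (f_pos : {ae lebesgue_tuple R d, forall x, cube R d x -> 0 < f x}).

Local Notation leb := (lebesgue_tuple R d).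
Local Notation lam := (uniform_cube R d).
Local Notation s := (fun y => Num.sqrt (f y)).

(** The uniform distribution too has a density, so that integrals against it and
    against F are both reduced to the same Lebesgue measure. *)
Lemma uniform_cubeE (A : set (d.-tuple R)) : measurable A ->
  lam A = (\int[leb]_(y in A) (\1_(cube R d) y)%:E)%E.
Proof.
move=> mA; rewrite integral_indic; [|exact: mA|exact: measurable_cube].
by rewrite /uniform_cube /mrestr setIC.
Qed.

Lemma measurable_indic_cube :
  measurable_fun setT (\1_(cube R d) : d.-tuple R -> R).
Proof. by apply: measurable_indic; exact: measurable_cube. Qed.

Lemma indic_cube_ge0 (y : d.-tuple R) : 0 <= \1_(cube R d) y :> R.
Proof. by rewrite indicE ler0n. Qed.

Lemma measurable_sqrt_density : measurable_fun setT s.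
Proof.
have [mf _ _] := F_density.
exact: measurableT_comp (continuous_measurable_fun (@sqrt_continuous R)) mf.
Qed.

Lemma measurable_rescale (phi : d.-tuple R -> R) :
  measurable_fun setT phi -> measurable_fun setT (rescale f phi).
Proof.
move=> mphi; apply: measurable_funM => //.
(* On nonnegative numbers, the inverse is the real power of exponent -1, also
   at 0 where both vanish. *)
rewrite (_ : (fun _ => _) = fun y => Num.sqrt (f y) `^ (-1)).
  apply: (@measurableT_comp _ _ _ _ _ _ (@powR R ^~ (-1))).
    exact: measurable_powR.
  exact: measurable_sqrt_density.
by apply/funext => y; rewrite powR_inv1// sqrtr_ge0.
Qed.

(** Outside the cube, the nonnegative [f] integrates to the F-measure of the
    complement, which is 0, hence vanishes almost everywhere. *)
Lemma ae_density_support : {ae leb, forall y, (0 < f y) = (y \in cube R d)}.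
Proof.
have [mf f0 FE] := F_density.
have mC : measurable (~` cube R d).
  by apply: measurableC; exact: measurable_cube.
have FC0 : F (~` cube R d) = 0%E.
  by rewrite probability_setC ?F_cube ?subee//; exact: measurable_cube.
have : ae_eq leb (~` cube R d) (EFin \o f) (cst 0%E).
  apply/ae_eq_integral_abs => //.
    by apply/measurable_EFinP; exact: measurable_funTS.
  rewrite -FC0 FE//.
  by apply: eq_integral => y _; rewrite gee0_abs// lee_fin.
move: f_pos; apply: filterS2 => y fpos f0y.
case: (boolP (y \in _)) => [/set_mem/fpos //|/negP yC].
have /= := f0y (fun yc => yC (mem_set yc)).
by move=> [->]; rewrite ltxx.
Qed.

Lemma integral_uniform_cube (phi : d.-tuple R -> R) :
  measurable_fun setT phi ->
  (\int[lam]_y (phi y)%:E = \int[leb]_y (phi y * \1_(cube R d) y)%:E)%E.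
Proof.
apply: integral_density.
- exact: measurable_indic_cube.
- exact: indic_cube_ge0.
- exact: uniform_cubeE.
Qed.

Lemma Rintegral_in_cube (phi : d.-tuple R -> R) :
  measurable_fun setT phi ->
  \int[leb]_(y in cube R d) phi y = \int[lam]_y phi y.
Proof.
move=> mphi; rewrite Rintegral_mkcond /Rintegral integral_uniform_cube//.
congr fine; apply: eq_integral => y _; rewrite patchE indicE.
by case: ifP => _; rewrite ?mulr1 ?mulr0.
Qed.

(** Integrals against F become integrals against the uniform distribution: the
    points where [f] vanishes and those outside the cube are the same up to a
    null set, so it suffices to compare the integrands where [f] is positive. *)
Lemma integral_transfer (h k : d.-tuple R -> R) :
  measurable_fun setT h -> measurable_fun setT k ->
  (forall y, 0 < f y -> h y * f y = k y) ->
  (\int[F]_y (h y)%:E = \int[lam]_y (k y)%:E)%E.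
Proof.
move=> mh mk hk; have [mf f0 FE] := F_density.
rewrite integral_uniform_cube// (integral_density mf f0 FE mh).
apply: ae_eq_integral => //.
- by apply/measurable_EFinP; exact: measurable_funM.
- apply/measurable_EFinP; apply: measurable_funM => //.
  exact: measurable_indic_cube.
- move: ae_density_support; apply: filterS => y supp _ /=.
  rewrite indicE -supp; case: (ltP 0 (f y)) => [/hk->|fle0].
    by rewrite mulr1.
  by rewrite (le_anti (introT andP (conj fle0 (f0 y)))) !mulr0.
Qed.

Lemma inner_rescale (phi psi : d.-tuple R -> R) :
  measurable_fun setT phi -> measurable_fun setT psi ->
  inner F (rescale f phi) (rescale f psi) = inner lam phi psi.
Proof.
move=> mphi mpsi; congr fine; apply: integral_transfer.
- by apply: measurable_funM; exact: measurable_rescale.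
- exact: measurable_funM.
- move=> y fy; rewrite /rescale -{3}(sqr_sqrtr (ltW fy)).
  by field; rewrite sqrtr_eq0 -ltNge.
Qed.

(** The constant 1 of L_2(F) is the image [s / s] of [s] under the isometry. *)
Lemma inner_rescale_cst1 (phi : d.-tuple R -> R) : measurable_fun setT phi ->
  inner F (rescale f phi) (cst 1) = inner lam phi s.
Proof.
move=> mphi; congr fine; apply: integral_transfer.
- by apply: measurable_funM => //; exact: measurable_rescale.
- by apply: measurable_funM => //; exact: measurable_sqrt_density.
- move=> y fy; rewrite /rescale /= -{2}(sqr_sqrtr (ltW fy)).
  by field; rewrite sqrtr_eq0 -ltNge.
Qed.

Lemma rescale_Lfun2 (phi : d.-tuple R -> R) :
  phi \in Lfun lam 2%:E -> rescale f phi \in Lfun F 2%:E.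
Proof.
move=> /Lfun2P[mphi phi2]; apply/Lfun2P; split; first exact: measurable_rescale.
rewrite (integral_transfer (k := fun y => phi y ^+ 2))//.
- by apply: measurable_funX; exact: measurable_rescale.
- exact: measurable_funX.
- move=> y fy; rewrite /rescale -{2}(sqr_sqrtr (ltW fy)).
  by field; rewrite sqrtr_eq0 -ltNge.
Qed.

(** [s] is a unit vector because F has total mass 1. *)
Lemma integral_sqrt_density_sqr : (\int[lam]_y (s y ^+ 2)%:E = 1)%E.
Proof.
rewrite -(integral_transfer (h := cst 1))//.
- exact: integral_probability1.
- by apply: measurable_funX; exact: measurable_sqrt_density.
- by move=> y fy; rewrite /= sqr_sqrtr ?mul1r// ltW.
Qed.

Lemma sqrt_density_Lfun2 : s \in Lfun lam 2%:E.
Proof.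
apply/Lfun2P; split; first exact: measurable_sqrt_density.
by rewrite integral_sqrt_density_sqr ltry.
Qed.

Lemma indic_cube_Lfun2 : \1_(cube R d) \in Lfun lam 2%:E.
Proof.
apply/Lfun2P; split; first exact: measurable_indic_cube.
rewrite (eq_integral (fun y => (\1_(cube R d) y)%:E)).
  by rewrite integral_indic ?setIT ?(le_lt_trans (probability_le1 _ _)) ?ltry//;
    exact: measurable_cube.
by move=> y _; rewrite indicE; case: (_ \in _); rewrite ?expr1n ?expr0n.
Qed.

(** The uniform distribution does not see the difference between the constant 1
    and the indicator of the cube; the latter is the function whose rescaling
    occurs in the transformed process. *)
Lemma inner_indic_cube (phi : d.-tuple R -> R) : measurable_fun setT phi ->
  inner lam phi \1_(cube R d) = inner lam phi (cst 1).
Proof.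
move=> mphi; congr fine; rewrite !integral_uniform_cube.
- apply: eq_integral => y _ /=; rewrite mulr1 indicE.
  by case: (_ \in _); rewrite ?mulr1 ?mulr0.
- by apply: measurable_funM.
- by apply: measurable_funM => //; exact: measurable_indic_cube.
Qed.

(** The inner product of [1] and [s] is the Hellinger affinity of F and the
    uniform distribution. Equality in the Cauchy-Schwarz inequality between
    these unit vectors forces [s = 1] almost everywhere, hence F uniform. *)
Lemma hellinger_affinity_neq1 (A : set (d.-tuple R)) :
  measurable A -> F A <> lam A -> inner lam (cst 1) s <> 1.
Proof.
move=> mA FA m1; apply: FA.
have [mf f0 FE] := F_density.
have s2 := sqrt_density_Lfun2.
have one2 : cst 1 \in Lfun lam 2%:E by exact: Lfun_cst.
pose r := fun y => 1 * cst 1 y + (-1) * s y.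
have r2 : r \in Lfun lam 2%:E by exact: Lfun2_lin.
have ss1 : inner lam s s = 1.
  by rewrite /inner /Rintegral; under eq_integral do rewrite -expr2;
    rewrite integral_sqrt_density_sqr.
have rr0 : inner lam r r = 0.
  rewrite inner_lin// innerC inner_lin// [inner lam s r]innerC inner_lin//.
  by rewrite [inner lam s (cst 1)]innerC m1 ss1 inner_cst11; ring.
have r0 : ae_eq lam setT (EFin \o r) (cst 0%E).
  have mr : measurable_fun setT (EFin \o (fun y => r y ^+ 2)).
    by apply/measurable_EFinP/measurable_funX; case/Lfun2P : r2.
  have : ae_eq lam setT (EFin \o (fun y => r y ^+ 2)) (cst 0%E).
    apply/ae_eq_integral_abs => //.
    rewrite (eq_integral (EFin \o (fun y => r y ^+ 2))) => [|y _]; last first.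
      by rewrite gee0_abs// lee_fin sqr_ge0.
    rewrite -[LHS]fineK; first by rewrite -[fine _]/(inner lam r r) rr0.
    exact: integrable_fin_num (Lfun2_integrable_sqr r2).
  apply: filterS => y /(_ I) /= [/eqP]; rewrite sqrf_eq0 => /eqP ry _.
  by rewrite ry.
have FAE : F A = (\int[F]_y (\1_A y)%:E)%E by rewrite integral_indic// setIT.
have lamAE : lam A = (\int[lam]_y (\1_A y)%:E)%E.
  by rewrite integral_indic// setIT.
rewrite FAE.
rewrite (integral_transfer (h := \1_A) (k := fun y => \1_A y * f y))//;
  last first.
  by apply: measurable_funM.
rewrite lamAE; apply: ae_eq_integral => //.
- by apply/measurable_EFinP; apply: measurable_funM.
- by apply/measurable_EFinP.
- apply: filterS r0 => y /(_ I) /= [ry] _.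
  suff -> : f y = 1 by rewrite mulr1.
  have sy : s y = 1 by rewrite /r /= in ry; lra.
  by rewrite -(sqr_sqrtr (f0 y)) sy expr1n.
Qed.
End rescaling.

(** * The transformed bridge *)

Lemma measurable_orthant {R : realType} {d : nat} (x : d.-tuple R) :
  measurable (orthant x).
Proof.
rewrite (_ : orthant x =
  \bigcap_(i in [set: 'I_d])
    ((fun y => tnth y i) @^-1` `]-oo, tnth x i]%classic)).
  apply: fin_bigcap_measurable => // i _; rewrite -[X in measurable X]setTI.
  by apply: measurable_tnth => //; exact: measurable_itv.
apply/seteqP; split => y h i; last by have := h i I; rewrite /= in_itv.
by move=> _; have := h i; rewrite /= in_itv.
Qed.

Section bridge.
Context {disp : measure_display} {T : measurableType disp} {R : realType}.
Context (P : probability T R) {d : nat}.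
Context (F : probability (d.-tuple R) R) (f : d.-tuple R -> R).
Context (v : (d.-tuple R -> R) -> {RV P >-> R}).
Context (F_cube : F (cube R d) = 1%E) (F_density : is_density F f).
Context (f_pos : {ae lebesgue_tuple R d, forall x, cube R d x -> 0 < f x}).
Context (v_bridge : brownian_bridge F v).

Local Notation lam := (uniform_cube R d).
Local Notation s := (fun y => Num.sqrt (f y)).
Local Notation onec := (\1_(cube R d) : d.-tuple R -> R).

Lemma bridge_Lfun2 (phi : d.-tuple R -> R) :
  phi \in Lfun F 2%:E -> (v phi : T -> R) \in Lfun P 2%:E.
Proof.
have [_ _ cov] := v_bridge.
by move=> phi2; apply: finite_variance_Lfun2; rewrite cov.
Qed.

Definition correction (phi : d.-tuple R -> R) : R :=
  inner lam phi (fun y => 1 - s y) / (1 - inner lam (cst 1) s).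

(** The process of the theorem extended from indicators of orthants to all
    functions. Almost surely, it is [v] at the rescaled
    [phi - correction phi * (1 - s)], the image of [phi] under the reflection that
    exchanges [1] and [s]: the term in [s / s] drops out because the bridge
    vanishes at constants. *)
Definition transform (phi : d.-tuple R -> R) : {RV P >-> R} :=
  (v (rescale f phi) : {mfun T >-> R})
  - correction phi *: (v (rescale f onec) : {mfun T >-> R}).

Lemma transformE phi w :
  transform phi w = v (rescale f phi) w - correction phi * v (rescale f onec) w.
Proof. by []. Qed.

Lemma one_sub_sqrt_Lfun2 : (fun y => 1 - s y) \in Lfun lam 2%:E.
Proof.
rewrite (_ : (fun _ => _) = fun y => 1 * cst 1 y + (- 1) * s y).
  by apply: Lfun2_lin; [exact: Lfun_cst|];
    exact: sqrt_density_Lfun2 F_cube F_density f_pos.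
by apply/funext => y /=; rewrite mul1r mulN1r.
Qed.

Lemma correction_lin (a b : R) (phi psi : d.-tuple R -> R) :
  phi \in Lfun lam 2%:E -> psi \in Lfun lam 2%:E ->
  correction (fun y => a * phi y + b * psi y) =
    a * correction phi + b * correction psi.
Proof.
move=> phi2 psi2; rewrite /correction inner_lin//.
  by rewrite mulrDl !mulrA.
exact: one_sub_sqrt_Lfun2.
Qed.

Lemma correctionE (phi : d.-tuple R -> R) : phi \in Lfun lam 2%:E ->
  correction phi = (inner lam phi (cst 1) - inner lam phi s)
             / (1 - inner lam (cst 1) s).
Proof.
move=> phi2; congr (_ / _).
rewrite innerC (_ : (fun _ => _) = fun y => 1 * cst 1 y + (- 1) * s y).
  rewrite inner_lin ?(sqrt_density_Lfun2 F_cube F_density f_pos) ?Lfun_cst//.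
  by rewrite mul1r mulN1r innerC [inner lam s phi]innerC.
by apply/funext => y /=; rewrite mul1r mulN1r.
Qed.

Lemma rescale_lin (a b : R) (phi psi : d.-tuple R -> R) :
  rescale f (fun y => a * phi y + b * psi y) =
  fun y => a * rescale f phi y + b * rescale f psi y.
Proof. by apply/funext => y; rewrite /rescale mulrDl !mulrA. Qed.

Lemma transform_linear (a b : R) (phi psi : d.-tuple R -> R) :
  phi \in Lfun lam 2%:E -> psi \in Lfun lam 2%:E ->
  {ae P, forall w, transform (fun y => a * phi y + b * psi y) w =
                   a * transform phi w + b * transform psi w}.
Proof.
move=> phi2 psi2; have [lin _ _] := v_bridge.
have := lin a b _ _ (rescale_Lfun2 F_cube F_density f_pos phi2)
  (rescale_Lfun2 F_cube F_density f_pos psi2).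
apply: filterS => w vw; rewrite !transformE rescale_lin vw correction_lin//.
by ring.
Qed.

Lemma transform_gaussian n (phi : 'I_n -> d.-tuple R -> R) (a : 'I_n -> R) :
  (forall i, phi i \in Lfun lam 2%:E) ->
  centered_gaussian P (fun w => \sum_(i < n) a i * transform (phi i) w).
Proof.
move=> phi2; have [_ gauss _] := v_bridge.
(* The corrections add up to one more multiple of the bridge at [onec / s];
   the last index is reserved for this term. *)
pose phi' (i : 'I_n.+1) := if unlift ord_max i is Some j then phi j else onec.
pose c := \sum_(j < n) a j * correction (phi j).
pose a' (i : 'I_n.+1) := if unlift ord_max i is Some j then a j else - c.
rewrite (_ : (fun _ => _) =
    fun w => \sum_(i < n.+1) a' i * v (rescale f (phi' i)) w).
  apply: (gauss _ (fun i => rescale f (phi' i))) => i.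
  apply: rescale_Lfun2 => //; rewrite /phi'; case: unlift => [j|]//.
  exact: indic_cube_Lfun2.
have aK j : a' (lift ord_max j) = a j by rewrite /a' liftK.
have phiK j : phi' (lift ord_max j) = phi j by rewrite /phi' liftK.
have a_max : a' ord_max = - c by rewrite /a' unlift_none.
have phi_max : phi' ord_max = onec by rewrite /phi' unlift_none.
apply/funext => w; rewrite (bigD1_ord ord_max)// a_max phi_max.
under [in RHS]eq_bigr do rewrite aK phiK.
under [in LHS]eq_bigr do rewrite transformE mulrBr mulrA.
by rewrite sumrB mulNr -mulr_suml addrC.
Qed.

(** Let [p = <phi, s>], [q = <psi, s>], [m = <1, s>] and let [a], [b] be the
    inner products of [phi], [psi] with [1 - s]. The covariances among the three
    bridge values involved are [<phi, psi> - p q], [a + p (1 - m)],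
    [b + q (1 - m)] and [1 - m ^ 2], which enter with the coefficients [1],
    [- b / (1 - m)], [- a / (1 - m)] and [a b / (1 - m) ^ 2]. Everything sums to
    [<phi, psi> - (p + a) (q + b)], where [p + a = <phi, 1>] and
    [q + b = <psi, 1>]. *)
Lemma transform_covariance (phi psi : d.-tuple R -> R) :
  inner lam (cst 1) s <> 1 ->
  phi \in Lfun lam 2%:E -> psi \in Lfun lam 2%:E ->
  covariance P (transform phi) (transform psi) =
    (inner lam phi psi
       - inner lam phi (cst 1) * inner lam psi (cst 1))%:E.
Proof.
move=> /eqP m1 phi2 psi2; have [_ _ cov] := v_bridge.
have onec2 : onec \in Lfun lam 2%:E by exact: indic_cube_Lfun2.
have L2 u : u \in Lfun lam 2%:E -> rescale f u \in Lfun F 2%:E.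
  exact: rescale_Lfun2.
have mL2 u : u \in Lfun lam 2%:E -> measurable_fun setT u by case/Lfun2P.
have covK u w : u \in Lfun lam 2%:E -> w \in Lfun lam 2%:E ->
    covariance P (v (rescale f u)) (v (rescale f w)) =
      (inner lam u w - inner lam u s * inner lam w s)%:E.
  move=> u2 w2; have [mu mw] := (mL2 _ u2, mL2 _ w2).
  rewrite cov ?L2// (inner_rescale F_cube F_density f_pos mu mw).
  by rewrite !(inner_rescale_cst1 F_cube F_density f_pos).
have inner_onec u : u \in Lfun lam 2%:E ->
    inner lam u onec = inner lam u (cst 1).
  by move=> u2; rewrite inner_indic_cube//; exact: mL2.
have onec1 : inner lam onec (cst 1) = 1.
  by rewrite innerC inner_indic_cube// inner_cst11.
have onecs : inner lam onec s = inner lam (cst 1) s.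
  rewrite innerC inner_onec; first exact: innerC.
  exact: sqrt_density_Lfun2 F_cube F_density f_pos.
rewrite (_ : (transform phi : T -> R) =
  v (rescale f phi) \- correction phi \o* v (rescale f onec)); last first.
  by apply/funext => w; rewrite transformE /= [_ * correction _]mulrC.
rewrite (_ : (transform psi : T -> R) =
  v (rescale f psi) \- correction psi \o* v (rescale f onec)); last first.
  by apply/funext => w; rewrite transformE /= [_ * correction _]mulrC.
rewrite covariance_shift ?bridge_Lfun2 ?L2// !covK// !inner_onec//.
rewrite [inner lam onec psi]innerC inner_onec// onec1 onecs !correctionE//.
rewrite -!EFinM -!EFinB; congr EFin; field.
by rewrite subr_eq0 eq_sym.
Qed.

Lemma transformed_bridgeE (x : d.-tuple R) (w : T) :
  transformed_bridge f v x w = transform \1_(orthant x) w.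
Proof.
have ms := measurable_sqrt_density F_density.
have mo : measurable_fun setT (\1_(orthant x) : d.-tuple R -> R).
  by apply: measurable_indic; exact: measurable_orthant.
rewrite transformE /transformed_bridge /correction; congr (_ - _ / (1 - _) * _).
- rewrite Rintegral_mkcondr /inner -Rintegral_in_cube.
    apply: eq_Rintegral => y _; rewrite patchE indicE.
    by case: ifP => _; rewrite ?mul1r ?mul0r.
  by apply: measurable_funM => //; exact: measurable_funB.
- rewrite Rintegral_in_cube// /inner.
  by apply: eq_Rintegral => y _; rewrite mul1r.
Qed.
End bridge.

Theorem proposition1 (R : realType) (d : nat)
    (disp : measure_display) (T : measurableType disp) (P : probability T R)
    (F : probability (d.-tuple R) R) (f : d.-tuple R -> R)
    (v : (d.-tuple R -> R) -> {RV P >-> R})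
    (F_cube : F (cube R d) = 1%E)
    (F_density : is_density F f)
    (f_pos : {ae lebesgue_tuple R d, forall x, cube R d x -> 0 < f x})
    (F_not_uniform : exists2 A : set (d.-tuple R),
       measurable A & F A <> uniform_cube R d A)
    (v_bridge : brownian_bridge F v) :
  standard_brownian_bridge P (transformed_bridge f v).
Proof.
have [A mA FA] := F_not_uniform.
have m1 := hellinger_affinity_neq1 F_cube F_density f_pos mA FA.
exists (transform f v); split; last first.
  by move=> x _; apply: aeW => w; exact: (transformed_bridgeE v F_density).
split.
- by move=> a b phi psi;
  exact: (transform_linear F_cube F_density f_pos v_bridge).
- by move=> n phi a;
  exact: (transform_gaussian F_cube F_density f_pos v_bridge).
- by move=> phi psi;
  exact: (transform_covariance F_cube F_density f_pos v_bridge m1).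
Qed.
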